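(* Let $c$ and $e$ be confocal ellipses with $c$ in the interior of $e$, and let $P_1P_2\dots P_N$ be an $N$-periodic billiard in $e$ with caustic $c$, with exterior angles $\theta_1,\dots,\theta_N$ at $P_1,\dots,P_N$. If $N\equiv 0\pmod 2$, then \[\sum_{i=1}^N(-1)^i\sin\theta_i=0,\] and if $N\equiv 0\pmod 4$, then \[\sum_{i=1}^{N/2}(-1)^i\sin\theta_i=0.\]
   Context: A billiard in $e$ with caustic $c$ is a sequence of points $P_1,P_2,\dots$ on $e$ such that each line $P_iP_{i+1}$ is tangent to $c$ and $P_{i-1}P_i$, $P_iP_{i+1}$ are the two tangents from $P_i$ to $c$; it is traversed counterclockwise and is $N$-periodic if $P_{i+N}=P_i$ for all $i$ (indices mod $N$). The exterior angle $\theta_i$ at $P_i$ is the angle between the directions $\overrightarrow{P_{i-1}P_i}$ and $\overrightarrow{P_iP_{i+1}}$; equivalently $\theta_i/2$ is the angle between each tangent from $P_i$ to $c$ and the tangent of $e$ at $P_i$. *)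

(* Defs.v *)
From Stdlib Require Import Reals Lra Lia.
Open Scope R_scope.

Definition pt := (R * R)%type.

Definition vsub (A B : pt) : pt := (fst A - fst B, snd A - snd B).
Definition dot (u v : pt) : R := fst u * fst v + snd u * snd v.
Definition cross (u v : pt) : R := fst u * snd v - snd u * fst v.
Definition norm (u : pt) : R := sqrt (dot u u).
Definition dist (A B : pt) : R := norm (vsub A B).

Definition is_ellipse (F1 F2 : pt) (s : R) : Prop := dist F1 F2 < s.
Definition on_ellipse (F1 F2 : pt) (s : R) (P : pt) : Prop :=
  dist P F1 + dist P F2 = s.

Definition line_pt (A B : pt) (t : R) : pt :=
  (fst A + t * (fst B - fst A), snd A + t * (snd B - snd A)).

Definition tangent_line (F1 F2 : pt) (s : R) (A B : pt) : Prop :=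
  A <> B /\ exists! t : R, on_ellipse F1 F2 s (line_pt A B t).

(* N-periodic billiard in e = (F1,F2,se) with caustic c = (F1,F2,sc) (confocal),
   indices in nat (P 0 = P N plays the role of P_0). *)
Definition periodic_billiard (F1 F2 : pt) (se sc : R) (N : nat) (P : nat -> pt) : Prop :=
  (forall i, P (i + N)%nat = P i) /\
  (forall i, on_ellipse F1 F2 se (P i)) /\
  (forall i, tangent_line F1 F2 sc (P i) (P (i + 1)%nat)) /\
  (* P_i P_{i+1} and P_{i+1} P_{i+2} are the two (distinct) tangents from P_{i+1} *)
  (forall i, cross (vsub (P (i + 1)%nat) (P i)) (vsub (P (i + 2)%nat) (P i)) <> 0) /\
  (* counterclockwise traversal: the caustic's centre lies to the left of each
     directed segment P_i -> P_{i+1} *)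
  (forall i, cross (vsub (P (i + 1)%nat) (P i))
                   (vsub ((fst F1 + fst F2) / 2, (snd F1 + snd F2) / 2) (P i)) > 0).

Definition angle (u v : pt) : R := acos (dot u v / (norm u * norm v)).

(* Exterior angle at P_i: angle between P_{i-1}P_i and P_iP_{i+1} (for i >= 1). *)
Definition ext_angle (P : nat -> pt) (i : nat) : R :=
  angle (vsub (P i) (P (i - 1)%nat)) (vsub (P (i + 1)%nat) (P i)).

Fixpoint sum1 (f : nat -> R) (n : nat) : R :=
  match n with
  | O => 0
  | S m => sum1 f m + f (S m)
  end.

(* Main.v *)
(* Let d_i be the distance from the centre to the edge P_i P_{i+1}.  Both edges at
   P_i make the same angle with the tangent of e there, and the Joachimsthal
   integral gives sin theta_i = K (d_{i-1} + d_i) with K depending only on e and c,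
   so alternating sums telescope.  This settles the first claim; the second one
   needs d_{N/2} = d_0.  For unit edge directions v_i, the quantity
   (v_i x v_j) / (d_i + d_j) depends only on the difference of the parameters in
   which the billiard is a translation, so it is unchanged under
   (i, j) -> (i+1, j+1); it is also antisymmetric.  Going from (0, N/2) to
   (N/2, N) it changes sign, hence vanishes: the edges 0 and N/2 are parallel and
   equally far from the centre. *)

Require Import Defs.
From Stdlib Require Import Reals Lra Lia.
Open Scope R_scope.

(** * Focal and Cartesian equations of an ellipse; tangency as a vanishing discriminant *)

Lemma Rsqr_eq_pos (u v : R) : 0 < u -> 0 < v -> u * u = v * v -> u = v.
Proof. intros Hu Hv H; apply Rsqr_inj; unfold Rsqr; lra. Qed.

Lemma sum_squares_nonneg (u v : R) : 0 <= u * u + v * v.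
Proof. apply Rplus_le_le_0_compat; apply Rle_0_sqr. Qed.

(** Subtracting the squares of the two distances gives [a r1 = a^2 + c x], which squares to the
    equation. Conversely the distances are [a + c x / a] and [a - c x / a], nonnegative because
    [|c x| <= a^2]. *)
Lemma focal_sum (a c x y : R) : 0 <= c < a ->
  sqrt ((x + c) * (x + c) + y * y) + sqrt ((x - c) * (x - c) + y * y) = 2 * a
  <-> (a * a - c * c) * (x * x) + a * a * (y * y) = a * a * (a * a - c * c).
Proof.
  intros [Hc Hca]; assert (Ha : 0 < a) by lra; split.
  - intros H.
    assert (H1 := sqrt_sqrt ((x + c) * (x + c) + y * y) (sum_squares_nonneg _ _)).
    assert (H2 := sqrt_sqrt ((x - c) * (x - c) + y * y) (sum_squares_nonneg _ _)).
    set (r1 := sqrt ((x + c) * (x + c) + y * y)) in *.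
    set (r2 := sqrt ((x - c) * (x - c) + y * y)) in *.
    assert (Hd : a * r1 = a * a + c * x).
    { replace r2 with (2 * a - r1) in H2 by lra. lra. }
    assert (Hsq : (a * r1) * (a * r1) = a * a * ((x + c) * (x + c) + y * y))
      by (rewrite <- H1; ring).
    rewrite Hd in Hsq; lra.
  - intros H.
    assert (Hb : 0 < a * a - c * c) by nra.
    assert (Hx : x * x <= a * a).
    { apply Rmult_le_reg_l with (a * a - c * c); nra. }
    assert (Hcx : Rabs (c * x) <= a * a).
    { rewrite Rabs_mult, (Rabs_pos_eq c) by lra.
      assert (Rabs x <= a) by (rewrite <- (Rabs_pos_eq a) by lra; apply Rsqr_le_abs_0; exact Hx).
      pose proof (Rabs_pos x); nra. }
    pose proof (Rle_abs (c * x)); pose proof (Rle_abs (- (c * x))) as Hcx'.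
    rewrite Rabs_Ropp in Hcx'.
    assert (Hy : y * y = (a * a - c * c) - (a * a - c * c) * (x * x) / (a * a)).
    { apply Rmult_eq_reg_l with (a * a); [| nra]. field_simplify; [nra | lra]. }
    assert (E1 : (x + c) * (x + c) + y * y = (a + c * x / a) * (a + c * x / a)).
    { rewrite Hy; field; lra. }
    assert (E2 : (x - c) * (x - c) + y * y = (a - c * x / a) * (a - c * x / a)).
    { rewrite Hy; field; lra. }
    assert (Hq : c * x / a * a = c * x) by (field; lra).
    rewrite E1, E2, !sqrt_square by nra; lra.
Qed.

(** By Vieta, [- 2 be / al - t] is a root along with [t]; uniqueness makes the root double. *)
Lemma quadratic_unique_root (al be ga : R) : 0 < al ->
  (exists! t, al * (t * t) + 2 * be * t + ga = 0) -> be * be = al * ga.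
Proof.
  intros Hal [t [Ht Hu]].
  assert (E : t = - (2 * be / al) - t).
  { apply Hu; rewrite <- Ht; field; lra. }
  assert (E' : be = - (al * t)).
  { apply Rmult_eq_reg_l with (2 / al).
    - replace (2 / al * be) with (2 * be / al) by (field; lra).
      replace (2 / al * - (al * t)) with (- (2 * t)) by (field; lra). lra.
    - apply Rgt_not_eq, Rdiv_lt_0_compat; lra. }
  subst be; nra.
Qed.

(** Restricted to the line, the equation of the ellipse is a quadratic in [t]; its discriminant
    condition, freed of a factor [a^2 b^2], is the claim. *)
Lemma line_tangent_to_ellipse (a b x0 y0 wx wy : R) : 0 < a -> 0 < b ->
  wx * wx + wy * wy <> 0 ->
  (exists! t, b * b * ((x0 + t * wx) * (x0 + t * wx))
              + a * a * ((y0 + t * wy) * (y0 + t * wy)) = a * a * (b * b)) ->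
  (x0 * wy - y0 * wx) * (x0 * wy - y0 * wx) = b * b * (wx * wx) + a * a * (wy * wy).
Proof.
  intros Ha Hb Hw [t [Ht Hu]].
  assert (Hab : 0 < a * a /\ 0 < b * b) by (split; nra).
  assert (Hal : 0 < b * b * (wx * wx) + a * a * (wy * wy)).
  { destruct (Req_dec wx 0) as [->|Hx].
    - assert (0 < wy * wy) by nra. nra.
    - assert (0 < wx * wx) by nra. nra. }
  assert (H := quadratic_unique_root (b * b * (wx * wx) + a * a * (wy * wy))
    (b * b * (x0 * wx) + a * a * (y0 * wy))
    (b * b * (x0 * x0) + a * a * (y0 * y0) - a * a * (b * b)) Hal).
  apply Rmult_eq_reg_l with (a * a * (b * b)); [| nra].
  enough (E : (b * b * (x0 * wx) + a * a * (y0 * wy)) * (b * b * (x0 * wx) + a * a * (y0 * wy))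
    = (b * b * (wx * wx) + a * a * (wy * wy)) *
      (b * b * (x0 * x0) + a * a * (y0 * y0) - a * a * (b * b))) by lra.
  apply H; exists t; split; [lra |].
  intros t' Ht'; apply Hu; lra.
Qed.

(** * A single chord of the outer ellipse touching the inner one *)

Lemma chord_lagrange (X0 Y0 X1 Y1 : R) :
  X0 * X0 + Y0 * Y0 = 1 -> X1 * X1 + Y1 * Y1 = 1 ->
  (X0 * Y1 - Y0 * X1) * (X0 * Y1 - Y0 * X1)
  = 1 - (X0 * X1 + Y0 * Y1) * (X0 * X1 + Y0 * Y1).
Proof.
  intros H0 H1.
  replace 1 with ((X0 * X0 + Y0 * Y0) * (X1 * X1 + Y1 * Y1)) by (rewrite H0, H1; ring).
  ring.
Qed.

(* [(A*X0, B*Y0)] and [(A*X1, B*Y1)] are two points of the outer ellipse whose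
   chord [(wx, wy)] touches the inner one; [m] is their cross product up to sign. *)
Section Chord.
Variables a b kap A B X0 Y0 X1 Y1 m : R.
Hypotheses (ha : 0 < a) (hb : 0 < b) (hk : 0 < kap) (hA : 0 < A) (hB : 0 < B).
Hypotheses (hAa : A * A = a * a + kap * kap) (hBb : B * B = b * b + kap * kap).
Hypotheses (h0 : X0 * X0 + Y0 * Y0 = 1) (h1 : X1 * X1 + Y1 * Y1 = 1).
Let wx := A * (X1 - X0).
Let wy := B * (Y1 - Y0).
Hypotheses (hm : 0 < m)
  (hcross : m * m = A * A * (B * B) * ((X0 * Y1 - Y0 * X1) * (X0 * Y1 - Y0 * X1)))
  (htan : m * m = b * b * (wx * wx) + a * a * (wy * wy)).

(** A nonzero [m] keeps the two unit vectors from being parallel, so Lagrange's identity makes the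
    bound strict. *)
Lemma chord_dot_lt1 : X0 * X1 + Y0 * Y1 < 1.
Proof.
  pose proof (chord_lagrange _ _ _ _ h0 h1) as L.
  assert (HD : 0 < (X0 * Y1 - Y0 * X1) * (X0 * Y1 - Y0 * X1)).
  { assert (0 < A * A * (B * B)) by (apply Rmult_lt_0_compat; nra).
    assert (0 < m * m) by nra.
    pose proof (Rle_0_sqr (X0 * Y1 - Y0 * X1)) as S; unfold Rsqr in S. nra. }
  nra.
Qed.

(* Conservation of the Joachimsthal integral. *)
Lemma chord_joachimsthal :
  A * B * (1 - (X0 * X1 + Y0 * Y1)) = kap * sqrt (wx * wx + wy * wy).
Proof.
  pose proof chord_dot_lt1 as C.
  pose proof (chord_lagrange _ _ _ _ h0 h1) as L.
  assert (S := sqrt_sqrt (wx * wx + wy * wy) (sum_squares_nonneg _ _)).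
  assert (Hl : 0 <= sqrt (wx * wx + wy * wy)) by apply sqrt_pos.
  apply Rsqr_inj; unfold Rsqr.
  - apply Rmult_le_pos; nra.
  - nra.
  - replace (kap * sqrt (wx * wx + wy * wy) * (kap * sqrt (wx * wx + wy * wy)))
      with (kap * kap * (wx * wx + wy * wy)) by (rewrite <- S at 1; ring).
    rewrite L in hcross.
    assert (E : (X1 - X0) * (X1 - X0) + (Y1 - Y0) * (Y1 - Y0)
                = 2 * (1 - (X0 * X1 + Y0 * Y1))) by lra.
    (* As [B^2 = b^2 + kap^2] and [A^2 = a^2 + kap^2], the left side is [m^2] plus [kap^2] times the
       squared length. With [t] the dot product, subtracting [m^2 = A^2 B^2 (1 - t^2)] leaves the
       perfect square [A^2 B^2 (1 - t)^2]. *)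
    assert (E2 : B * B * (wx * wx) + A * A * (wy * wy)
       = A * A * (B * B) * (2 * (1 - (X0 * X1 + Y0 * Y1)))).
    { rewrite <- E; unfold wx, wy; ring. }
    rewrite hAa, hBb in E2 at 1. nra.
Qed.

(** At [(cos t, sin t)] this is the speed of [(a cos t, b sin t)], up to scaling a Jacobi [dn]. *)
Let Z0 := sqrt (a * a * (Y0 * Y0) + b * b * (X0 * X0)).
Let Z1 := sqrt (a * a * (Y1 * Y1) + b * b * (X1 * X1)).

(** Counterpart of [chord_joachimsthal] with vertex and touching point exchanged. Lagrange's
    identity and [htan] give the square of the claim; the sign needs a separate argument. *)
Lemma chord_caustic_normal :
  B * (a * a) * wy * Y1 + A * (b * b) * wx * X1 = kap * m * Z1.
Proof.
  assert (hab : 0 < a * a /\ 0 < b * b) by (split; nra).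
  assert (pos : forall u v, u * u + v * v = 1 -> 0 < a * a * (v * v) + b * b * (u * u)).
  { intros u v H; destruct (Req_dec u 0) as [->|Hu].
    - assert (v * v = 1) by lra; nra.
    - assert (0 < u * u) by nra; nra. }
  assert (Q0 := pos _ _ h0). assert (Q1 := pos _ _ h1).
  assert (S0 := sqrt_sqrt _ (Rlt_le _ _ Q0)). assert (S1 := sqrt_sqrt _ (Rlt_le _ _ Q1)).
  assert (P0 := sqrt_lt_R0 _ Q0). assert (P1 := sqrt_lt_R0 _ Q1).
  fold Z0 in S0, P0. fold Z1 in S1, P1.
  pose proof chord_dot_lt1 as C.
  set (N := B * (a * a) * wy * Y1 + A * (b * b) * wx * X1).
  set (I := b * b * (X0 * X1) + a * a * (Y0 * Y1)).
  (* For chord ends [(x0, y0)] and [(x1, y1)], [be] is the polarised equation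
     [b^2 x0 x1 + a^2 y0 y1 - a^2 b^2] of the inner ellipse. Tangency means that its square is the
     product of the values at the two ends, [kap^2 Z0^2] and [kap^2 Z1^2]. *)
  set (be := kap * kap * I - a * a * (b * b) * (1 - (X0 * X1 + Y0 * Y1))).
  assert (EN : N = kap * kap * (Z1 * Z1) - be).
  { unfold N, be, wx, wy. rewrite S1.
    replace (B * (a * a) * (B * (Y1 - Y0)) * Y1) with (B * B * (a * a * ((Y1 - Y0) * Y1))) by ring.
    replace (A * (b * b) * (A * (X1 - X0)) * X1) with (A * A * (b * b * ((X1 - X0) * X1))) by ring.
    rewrite hAa, hBb; unfold I.
    replace 1 with (X1 * X1 + Y1 * Y1) at 1. ring. }
  assert (Hwm : m * m = (A * X1 * wy - B * Y1 * wx) * (A * X1 * wy - B * Y1 * wx)).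
  { rewrite hcross; unfold wx, wy; ring. }
  assert (EN2 : N * N = kap * kap * (m * m) * (Z1 * Z1)).
  { assert (L : N * N = (b * b * (wx * wx) + a * a * (wy * wy))
       * (b * b * (A * A) * (X1 * X1) + a * a * (B * B) * (Y1 * Y1))
       - a * a * (b * b) * ((A * X1 * wy - B * Y1 * wx) * (A * X1 * wy - B * Y1 * wx))).
    { unfold N; ring. }
    rewrite L, <- Hwm, <- htan, hAa, hBb, S1.
    replace (a * a * (b * b) * (m * m))
      with (a * a * (b * b) * (m * m) * (X1 * X1 + Y1 * Y1)) by (rewrite h1; ring).
    ring. }
  (* Tangency fixes [be] up to sign; Cauchy-Schwarz on [I] selects the negative
     root, i.e. the touching point lies between the ends of the chord. *)
  assert (HI : I <= Z0 * Z1).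
  { assert (I * I <= (Z0 * Z1) * (Z0 * Z1)).
    { replace (Z0 * Z1 * (Z0 * Z1)) with ((Z0 * Z0) * (Z1 * Z1)) by ring.
      rewrite S0, S1. unfold I.
      pose proof (Rle_0_sqr (a * b * (X0 * Y1 - Y0 * X1))) as T; unfold Rsqr in T. lra. }
    assert (0 < Z0 * Z1) by nra. nra. }
  assert (Ebe : be * be = kap * kap * (Z0 * Z0) * (kap * kap * (Z1 * Z1))).
  { set (S00 := b * b * (A * A) * (X0 * X0) + a * a * (B * B) * (Y0 * Y0)).
    set (S01 := b * b * (A * A) * (X0 * X1) + a * a * (B * B) * (Y0 * Y1)).
    set (S11 := b * b * (A * A) * (X1 * X1) + a * a * (B * B) * (Y1 * Y1)).
    set (e := a * a * (b * b)).
    assert (T1 : m * m = S11 - 2 * S01 + S00)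
      by (rewrite htan; unfold S00, S01, S11, wx, wy; ring).
    assert (T2 : S11 * S00 - S01 * S01 = e * (m * m))
      by (rewrite hcross; unfold S00, S01, S11, e; ring).
    assert (E0 : kap * kap * (Z0 * Z0) = S00 - e).
    { rewrite S0; unfold S00, e; rewrite hAa, hBb.
      replace (a * a * (b * b)) with (a * a * (b * b) * (X0 * X0 + Y0 * Y0))
        by (rewrite h0; ring). ring. }
    assert (E1 : kap * kap * (Z1 * Z1) = S11 - e).
    { rewrite S1; unfold S11, e; rewrite hAa, hBb.
      replace (a * a * (b * b)) with (a * a * (b * b) * (X1 * X1 + Y1 * Y1))
        by (rewrite h1; ring). ring. }
    assert (E2 : be = S01 - e)
      by (unfold be, I, S01, e; rewrite hAa, hBb; ring).
    rewrite E0, E1, E2. rewrite T1 in T2. lra. }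
  assert (Hbe : be < kap * kap * (Z0 * Z1)).
  { unfold be.
    assert (0 < a * a * (b * b) * (1 - (X0 * X1 + Y0 * Y1))) by (apply Rmult_lt_0_compat; nra).
    assert (0 < kap * kap) by nra. nra. }
  assert (Hneg : be = - (kap * kap * (Z0 * Z1))).
  { assert (F : (be - kap * kap * (Z0 * Z1)) * (be + kap * kap * (Z0 * Z1)) = 0) by nra.
    apply Rmult_integral in F; lra. }
  apply Rsqr_eq_pos.
  - rewrite EN, Hneg. assert (0 < kap * kap) by nra.
    assert (0 < kap * kap * (Z0 * Z1)) by (apply Rmult_lt_0_compat; nra). nra.
  - apply Rmult_lt_0_compat; nra.
  - rewrite EN2; ring.
Qed.
End Chord.

(* [lam] carries the orientation: positive when the vertex [(X, Y)] lies ahead of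
   the touching point [(x, y)], negative when it lies behind. *)
Lemma half_step_invariant (p q lam x1 y1 z1 X1 Y1 Z1 x2 y2 z2 X2 Y2 Z2 : R) :
  lam <> 0 ->
  x1 * x1 + y1 * y1 = 1 -> x2 * x2 + y2 * y2 = 1 ->
  X1 * X1 + Y1 * Y1 = 1 -> X2 * X2 + Y2 * Y2 = 1 ->
  p * x1 * X1 + q * y1 * Y1 = 1 -> p * x2 * X2 + q * y2 * Y2 = 1 ->
  p * x1 * Y1 - q * y1 * X1 = lam * z1 -> p * x2 * Y2 - q * y2 * X2 = lam * z2 ->
  q * x1 * Y1 - p * y1 * X1 = lam * Z1 -> q * x2 * Y2 - p * y2 * X2 = lam * Z2 ->
  (X1 * Y2 - X2 * Y1) * (z1 + z2) = (x1 * y2 - x2 * y1) * (Z1 + Z2).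
Proof.
  (* [key] serves twice, with touching points and vertices interchanged: both products reduce, up to
     sign, to the same antisymmetrised polar form. *)
  assert (key : forall u1 v1 u2 v2 U1 V1 U2 V2 r s : R,
    U1 * U1 + V1 * V1 = 1 -> U2 * U2 + V2 * V2 = 1 ->
    r * u1 * U1 + s * v1 * V1 = 1 -> r * u2 * U2 + s * v2 * V2 = 1 ->
    (U1 * V2 - U2 * V1) * (r * u1 * V1 - s * v1 * U1 + (r * u2 * V2 - s * v2 * U2))
    = r * u2 * U1 + s * v2 * V1 - (r * u1 * U2 + s * v1 * V2)).
  { intros u1 v1 u2 v2 U1 V1 U2 V2 r s E1 E2 T1 T2.
    set (C := U1 * U2 + V1 * V2).
    assert (D1 : (U1 * V2 - U2 * V1) * V1 = C * U1 - U2 * (U1 * U1 + V1 * V1)) by (unfold C; ring).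
    assert (D2 : (U1 * V2 - U2 * V1) * U1 = V2 * (U1 * U1 + V1 * V1) - C * V1) by (unfold C; ring).
    assert (D3 : (U1 * V2 - U2 * V1) * V2 = U1 * (U2 * U2 + V2 * V2) - C * U2) by (unfold C; ring).
    assert (D4 : (U1 * V2 - U2 * V1) * U2 = C * V2 - V1 * (U2 * U2 + V2 * V2)) by (unfold C; ring).
    rewrite E1 in D1, D2; rewrite E2 in D3, D4.
    transitivity (C * (r * u1 * U1 + s * v1 * V1) - C * (r * u2 * U2 + s * v2 * V2)
      + (r * u2 * U1 + s * v2 * V1 - (r * u1 * U2 + s * v1 * V2))).
    2: { rewrite T1, T2; ring. }
    transitivity (r * u1 * ((U1 * V2 - U2 * V1) * V1) - s * v1 * ((U1 * V2 - U2 * V1) * U1)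
      + r * u2 * ((U1 * V2 - U2 * V1) * V2) - s * v2 * ((U1 * V2 - U2 * V1) * U2)).
    { ring. }
    rewrite D1, D2, D3, D4; ring. }
  intros hl e1 e2 E1 E2 t1 t2 j1 j2 n1 n2.
  assert (K1 := key x1 y1 x2 y2 X1 Y1 X2 Y2 p q E1 E2 t1 t2).
  assert (K2 := key X1 Y1 X2 Y2 x1 y1 x2 y2 p q e1 e2 ltac:(lra) ltac:(lra)).
  apply Rmult_eq_reg_l with lam; [| exact hl].
  replace (lam * ((X1 * Y2 - X2 * Y1) * (z1 + z2)))
    with ((X1 * Y2 - X2 * Y1) * (lam * z1 + lam * z2)) by ring.
  replace (lam * ((x1 * y2 - x2 * y1) * (Z1 + Z2)))
    with ((x1 * y2 - x2 * y1) * (lam * Z1 + lam * Z2)) by ring.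
  rewrite <- j1, <- j2, <- n1, <- n2, K1. lra.
Qed.

(** In the orthonormal frame [(X, Y)], [(Y, -X)] the vector [(p x, q y)] has components [1] and
    [lam z], its primed analogue [1] and [- lam z']; the cross product follows. *)
Lemma cross_of_tangents_from_vertex (p q lam x y z x' y' z' X Y : R) :
  X * X + Y * Y = 1 ->
  p * x * X + q * y * Y = 1 -> p * x * Y - q * y * X = lam * z ->
  p * x' * X + q * y' * Y = 1 -> p * x' * Y - q * y' * X = - lam * z' ->
  p * q * (x * y' - y * x') = lam * (z + z').
Proof.
  intros E t j t' j'.
  assert (Ex : p * x = X + lam * z * Y)
    by (transitivity (p * x * (X * X + Y * Y)); [rewrite E; ring |
        rewrite <- j; transitivity (X * (p * x * X + q * y * Y) + (p * x * Y - q * y * X) * Y);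
        [ring | rewrite t; ring]]).
  assert (Ey : q * y = Y - lam * z * X)
    by (transitivity (q * y * (X * X + Y * Y)); [rewrite E; ring |
        rewrite <- j; transitivity (Y * (p * x * X + q * y * Y) - (p * x * Y - q * y * X) * X);
        [ring | rewrite t; ring]]).
  assert (Ex' : p * x' = X + - lam * z' * Y)
    by (transitivity (p * x' * (X * X + Y * Y)); [rewrite E; ring |
        rewrite <- j'; transitivity (X * (p * x' * X + q * y' * Y) + (p * x' * Y - q * y' * X) * Y);
        [ring | rewrite t'; ring]]).
  assert (Ey' : q * y' = Y - - lam * z' * X)
    by (transitivity (q * y' * (X * X + Y * Y)); [rewrite E; ring |
        rewrite <- j'; transitivity (Y * (p * x' * X + q * y' * Y) - (p * x' * Y - q * y' * X) * X);
        [ring | rewrite t'; ring]]).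
  transitivity ((p * x) * (q * y') - (q * y) * (p * x')); [ring |].
  rewrite Ex, Ey, Ex', Ey'.
  transitivity (lam * (z + z') * (X * X + Y * Y)); [ring | rewrite E; ring].
Qed.

(** * The billiard as a chain of tangent chords, and its translation invariant *)

Section Billiard.
Variables (a b kap A B : R) (X Y : nat -> R).
Hypotheses (ha : 0 < a) (hb : 0 < b) (hk : 0 < kap) (hA : 0 < A) (hB : 0 < B).
Hypotheses (hAa : A * A = a * a + kap * kap) (hBb : B * B = b * b + kap * kap).
Hypothesis hunit : forall i, X i * X i + Y i * Y i = 1.
Let wx i := A * (X (S i) - X i).
Let wy i := B * (Y (S i) - Y i).
(** Vertices are [(A X i, B Y i)], so this is the cross product of consecutive ones, and
    [m i / len i] is the distance from the centre to edge [i]. *)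
Let m i := A * B * (X i * Y (S i) - Y i * X (S i)).
Let len i := sqrt (wx i * wx i + wy i * wy i).
Hypothesis hm : forall i, 0 < m i.
Hypothesis htan : forall i, m i * m i = b * b * (wx i * wx i) + a * a * (wy i * wy i).

(* The edge [i] touches the inner ellipse at [(a * ex i, b * ey i)]. *)
Let ex i := a * wy i / m i.
Let ey i := - (b * wx i / m i).
(** [a b] over the distance from the centre to the edge. By [edge_z_sqr] it is the same function of
    the touching point as [Z] is of the vertex. *)
Let ez i := a * b * len i / m i.
Let Z i := sqrt (a * a * (Y i * Y i) + b * b * (X i * X i)).
Let p := A / a.
Let q := B / b.
Let lam := kap / (a * b).

Lemma edge_length_pos i : 0 < len i.
Proof.
  apply sqrt_lt_R0; destruct (sum_squares_nonneg (wx i) (wy i)) as [H | H]; [exact H |].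
  specialize (hm i); specialize (htan i).
  assert (wx i * wx i = 0 /\ wy i * wy i = 0) as [Ex Ey]
    by (pose proof (Rle_0_sqr (wx i)); pose proof (Rle_0_sqr (wy i)); unfold Rsqr in *; lra).
  rewrite Ex, Ey in htan; nra.
Qed.

Lemma edge_z_pos i : 0 < ez i.
Proof.
  apply Rdiv_lt_0_compat; [| apply hm].
  apply Rmult_lt_0_compat; [nra | apply edge_length_pos].
Qed.

Lemma edge_unit i : ex i * ex i + ey i * ey i = 1.
Proof.
  specialize (hm i); specialize (htan i).
  transitivity ((b * b * (wx i * wx i) + a * a * (wy i * wy i)) / (m i * m i)).
  - unfold ex, ey; field; lra.
  - rewrite <- htan; field; lra.
Qed.

Lemma edge_z_sqr i : ez i * ez i = a * a * (ey i * ey i) + b * b * (ex i * ex i).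
Proof.
  specialize (hm i).
  transitivity (a * a * (b * b) * (len i * len i) / (m i * m i)).
  - unfold ez; field; lra.
  - unfold len; rewrite sqrt_sqrt by apply sum_squares_nonneg.
    unfold ex, ey; field; lra.
Qed.

(** In order: the vertex lies on the tangent at the touching point, the Joachimsthal identity, and
    [chord_caustic_normal]. *)
Lemma edge_end i :
  p * ex i * X (S i) + q * ey i * Y (S i) = 1 /\
  p * ex i * Y (S i) - q * ey i * X (S i) = lam * ez i /\
  q * ex i * Y (S i) - p * ey i * X (S i) = lam * Z (S i).
Proof.
  pose proof (hm i) as M; pose proof (hunit i) as U0; pose proof (hunit (S i)) as U1.
  assert (hc : m i * m i = A * A * (B * B) *
    ((X i * Y (S i) - Y i * X (S i)) * (X i * Y (S i) - Y i * X (S i)))) by (unfold m; ring).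
  assert (J := chord_joachimsthal a b kap A B _ _ _ _ (m i) hk hA hB hAa hBb U0 U1 M hc (htan i)).
  assert (N := chord_caustic_normal a b kap A B _ _ _ _ (m i) ha hb hk hA hB hAa hBb U0 U1 M hc (htan i)).
  fold (wx i) in J, N; fold (wy i) in J, N; fold (len i) in J. fold (Z (S i)) in N.
  assert (J' : A * wy i * Y (S i) + B * wx i * X (S i) = kap * len i).
  { rewrite <- J; unfold wx, wy; rewrite <- U1; ring. }
  repeat split.
  - transitivity ((A * X (S i) * wy i - B * Y (S i) * wx i) / m i).
    + unfold p, q, ex, ey; field; lra.
    + replace (A * X (S i) * wy i - B * Y (S i) * wx i) with (m i)
        by (unfold m, wx, wy; ring). field; lra.
  - transitivity ((A * wy i * Y (S i) + B * wx i * X (S i)) / m i).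
    + unfold p, q, ex, ey; field; lra.
    + rewrite J'; unfold lam, ez; field; lra.
  - transitivity ((B * (a * a) * wy i * Y (S i) + A * (b * b) * wx i * X (S i)) / (a * b * m i)).
    + unfold p, q, ex, ey; field; lra.
    + rewrite N; unfold lam; field; lra.
Qed.

(** The sign of [lam] flips because the start lies behind the touching point; the last relation is
    [chord_caustic_normal] for the reversed chord. *)
Lemma edge_start i :
  p * ex i * X i + q * ey i * Y i = 1 /\
  p * ex i * Y i - q * ey i * X i = - lam * ez i /\
  q * ex i * Y i - p * ey i * X i = - lam * Z i.
Proof.
  pose proof (hm i) as M; pose proof (hunit i) as U0; pose proof (hunit (S i)) as U1.
  assert (hc : m i * m i = A * A * (B * B) *
    ((X i * Y (S i) - Y i * X (S i)) * (X i * Y (S i) - Y i * X (S i)))) by (unfold m; ring).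
  assert (hc' : m i * m i = A * A * (B * B) *
    ((X (S i) * Y i - Y (S i) * X i) * (X (S i) * Y i - Y (S i) * X i))) by (unfold m; ring).
  assert (ht' : m i * m i = b * b * ((A * (X i - X (S i))) * (A * (X i - X (S i))))
    + a * a * ((B * (Y i - Y (S i))) * (B * (Y i - Y (S i)))))
    by (rewrite htan; unfold wx, wy; ring).
  assert (J := chord_joachimsthal a b kap A B _ _ _ _ (m i) hk hA hB hAa hBb U0 U1 M hc (htan i)).
  assert (N := chord_caustic_normal a b kap A B _ _ _ _ (m i) ha hb hk hA hB hAa hBb U1 U0 M hc' ht').
  fold (wx i) in J; fold (wy i) in J; fold (len i) in J. fold (Z i) in N.
  replace (A * (X i - X (S i))) with (- wx i) in N by (unfold wx; ring).
  replace (B * (Y i - Y (S i))) with (- wy i) in N by (unfold wy; ring).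
  assert (J' : A * wy i * Y i + B * wx i * X i = - (kap * len i)).
  { rewrite <- J; unfold wx, wy; rewrite <- U0; ring. }
  repeat split.
  - transitivity ((A * X i * wy i - B * Y i * wx i) / m i).
    + unfold p, q, ex, ey; field; lra.
    + replace (A * X i * wy i - B * Y i * wx i) with (m i)
        by (unfold m, wx, wy; ring). field; lra.
  - transitivity ((A * wy i * Y i + B * wx i * X i) / m i).
    + unfold p, q, ex, ey; field; lra.
    + rewrite J'; unfold lam, ez; field; lra.
  - transitivity (- (B * (a * a) * - wy i * Y i + A * (b * b) * - wx i * X i) / (a * b * m i)).
    + unfold p, q, ex, ey; field; lra.
    + rewrite N; unfold lam; field; lra.
Qed.

(** The sine of the exterior angle at vertex [S i] as a constant times a sum of two distances. One
    edge ends at this vertex and the next starts there, so both touching points satisfy relations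
    with the same [(X, Y)]. *)
Lemma cross_consecutive_edges i :
  (wx i * wy (S i) - wy i * wx (S i)) / (len i * len (S i))
  = kap / (A * B) * (m i / len i + m (S i) / len (S i)).
Proof.
  destruct (edge_end i) as (t & j & _). destruct (edge_start (S i)) as (t' & j' & _).
  assert (K := cross_of_tangents_from_vertex p q lam _ _ _ _ _ _ _ _ (hunit (S i)) t j t' j').
  pose proof (edge_length_pos i); pose proof (edge_length_pos (S i)).
  pose proof (hm i); pose proof (hm (S i)).
  transitivity (m i * m (S i) / (A * B * (len i * len (S i)))
    * (p * q * (ex i * ey (S i) - ey i * ex (S i)))).
  - unfold p, q, ex, ey; field; repeat split; lra.
  - rewrite K; unfold lam, ez; field; repeat split; lra.
Qed.

(* In the uniformisation by Jacobi functions of [u], in which the billiard map is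
   a translation, this is a multiple of [sn d / (1 + dn d)] with [d = u j - u i]. *)
Let H i j := (ex i * ey j - ex j * ey i) / (ez i + ez j).

(** A shift is two half steps: from the touching points of edges [i], [j] to the vertices [S i],
    [S j], then on to the next touching points. Both sides equal the cross product of the vertices'
    unit vectors divided by [Z (S i) + Z (S j)]. *)
Lemma H_shift i j : H (S i) (S j) = H i j.
Proof.
  assert (hl : 0 < lam) by (unfold lam; apply Rdiv_lt_0_compat; nra).
  destruct (edge_end i) as (t1 & j1 & n1). destruct (edge_end j) as (t2 & j2 & n2).
  destruct (edge_start (S i)) as (s1 & k1 & o1). destruct (edge_start (S j)) as (s2 & k2 & o2).
  assert (I1 := half_step_invariant p q lam _ _ _ _ _ _ _ _ _ _ _ _ ltac:(lra)
    (edge_unit i) (edge_unit j) (hunit (S i)) (hunit (S j)) t1 t2 j1 j2 n1 n2).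
  assert (I2 := half_step_invariant p q (- lam) _ _ _ _ _ _ _ _ _ _ _ _ ltac:(lra)
    (edge_unit (S i)) (edge_unit (S j)) (hunit (S i)) (hunit (S j)) s1 s2 k1 k2 o1 o2).
  pose proof (edge_z_pos i); pose proof (edge_z_pos j).
  pose proof (edge_z_pos (S i)); pose proof (edge_z_pos (S j)).
  assert (pos : 0 < Z (S i)).
  { apply sqrt_lt_R0. pose proof (hunit (S i)).
    assert (0 < a * a /\ 0 < b * b) by (split; nra).
    destruct (Req_dec (X (S i)) 0) as [E | E].
    - rewrite E in *; nra.
    - assert (0 < X (S i) * X (S i)) by nra; nra. }
  assert (0 <= Z (S j)) by apply sqrt_pos.
  unfold H. apply Rmult_eq_reg_r with (Z (S i) + Z (S j)); [| lra].
  transitivity (X (S i) * Y (S j) - X (S j) * Y (S i)).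
  - replace (_ / _ * _) with ((ex (S i) * ey (S j) - ex (S j) * ey (S i)) * (Z (S i) + Z (S j))
      / (ez (S i) + ez (S j))) by (field; lra).
    rewrite <- I2; field; lra.
  - replace (_ / (ez i + ez j) * _) with ((ex i * ey j - ex j * ey i) * (Z (S i) + Z (S j))
      / (ez i + ez j)) by (field; lra).
    rewrite <- I1; field; lra.
Qed.

(* [H] is antisymmetric and shift invariant, so [H 0 h = H h (2h) = H h 0 = - H 0 h],
   and [H 0 h = 0] makes the edges [0] and [h] parallel. *)
Lemma support_half_period h :
  (forall i, X (i + (h + h))%nat = X i) -> (forall i, Y (i + (h + h))%nat = Y i) ->
  m h / len h = m 0%nat / len 0%nat.
Proof.
  intros PX PY.
  assert (sh : forall n, H n (n + h) = H 0 h).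
  { induction n as [| n IH]; [reflexivity | simpl; rewrite H_shift; exact IH]. }
  assert (Ew : wx (h + h) = wx 0 /\ wy (h + h) = wy 0 /\ m (h + h) = m 0).
  { unfold wx, wy, m. assert (PX0 := PX 0%nat); assert (PY0 := PY 0%nat).
    assert (PX1 := PX 1%nat); assert (PY1 := PY 1%nat); simpl in *.
    rewrite PX0, PY0, PX1, PY1; auto. }
  destruct Ew as (E1 & E2 & E3).
  assert (Hh := sh h).
  assert (D : ex 0 * ey h - ex h * ey 0 = 0).
  { revert Hh; unfold H.
    replace (ex (h + h)) with (ex 0) by (unfold ex; rewrite E2, E3; reflexivity).
    replace (ey (h + h)) with (ey 0) by (unfold ey; rewrite E1, E3; reflexivity).
    replace (ez (h + h)) with (ez 0) by (unfold ez, len; rewrite E1, E2, E3; reflexivity).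
    pose proof (edge_z_pos 0); pose proof (edge_z_pos h). intros Hh.
    apply (f_equal (fun r => r * (ez 0 + ez h))) in Hh.
    replace (_ / (ez h + ez 0) * _) with (- (ex 0 * ey h - ex h * ey 0)) in Hh by (field; lra).
    replace (_ / (ez 0 + ez h) * _) with (ex 0 * ey h - ex h * ey 0) in Hh by (field; lra).
    lra. }
  assert (U0 := edge_unit 0); assert (Uh := edge_unit h).
  (* Parallel unit vectors agree up to sign, so their squared coordinates agree, and these determine
     the positive number [ez]. *)
  assert (Ex : ex h * ex h = ex 0 * ex 0).
  { transitivity (ex h * ex h * (ex 0 * ex 0 + ey 0 * ey 0)); [rewrite U0; ring |].
    transitivity (ex 0 * ex 0 * (ex h * ex h + ey h * ey h)); [| rewrite Uh; ring].
    assert (ex 0 * ey h = ex h * ey 0) as D' by lra.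
    transitivity (ex h * ex h * (ex 0 * ex 0) + (ex h * ey 0) * (ex h * ey 0)); [ring |].
    rewrite <- D'; ring. }
  assert (Ez : ez h = ez 0).
  { apply Rsqr_eq_pos; try apply edge_z_pos. rewrite !edge_z_sqr, Ex.
    replace (ey h * ey h) with (ey 0 * ey 0) by lra; reflexivity. }
  assert (S : forall i, m i / len i = a * b / ez i).
  { intros i; pose proof (edge_length_pos i); pose proof (hm i); unfold ez; field; lra. }
  rewrite !S, Ez; reflexivity.
Qed.
End Billiard.

(** * Sines of angles and alternating sums *)

(** [acos] yields an unsigned angle, with nonnegative sine; the sign condition on the cross product
    matches it, and Lagrange's identity gives the square. *)
Lemma sin_angle (u v : pt) : 0 < norm u -> 0 < norm v -> 0 <= cross u v ->
  sin (angle u v) = cross u v / (norm u * norm v).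
Proof.
  intros Hu Hv Hc.
  assert (Su : norm u * norm u = dot u u) by (apply sqrt_sqrt, sum_squares_nonneg).
  assert (Sv : norm v * norm v = dot v v) by (apply sqrt_sqrt, sum_squares_nonneg).
  set (t := dot u v / (norm u * norm v)).
  set (s := cross u v / (norm u * norm v)).
  assert (E : s * s + t * t = 1).
  { transitivity ((cross u v * cross u v + dot u v * dot u v)
                  / ((norm u * norm u) * (norm v * norm v))).
    - unfold s, t; field; lra.
    - replace (cross u v * cross u v + dot u v * dot u v) with (dot u u * dot v v)
        by (unfold cross, dot; ring).
      rewrite <- Su, <- Sv; field; lra. }
  assert (Hs : 0 <= s) by (apply Rmult_le_pos; [exact Hc | apply Rlt_le, Rinv_0_lt_compat; nra]).
  unfold angle; fold t. rewrite sin_acos by nra.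
  replace (1 - t²) with (s * s) by (unfold Rsqr; lra).
  apply sqrt_square; exact Hs.
Qed.

Lemma alternating_sum_telescopes (f g : nat -> R) (n : nat) :
  (forall i, f (S i) = g i + g (S i)) ->
  sum1 (fun i => (-1) ^ i * f i) n = (-1) ^ n * g n - g 0%nat.
Proof.
  intros H; induction n as [| n IH]; simpl; [ring |].
  rewrite IH, H; ring.
Qed.

(** * Orthonormal coordinates centred midway between the foci *)

Lemma focal_frame (F1 F2 : pt) : exists e1 e2 : R,
  e1 * e1 + e2 * e2 = 1 /\
  fst F2 - fst F1 = Defs.dist F1 F2 * e1 /\ snd F2 - snd F1 = Defs.dist F1 F2 * e2.
Proof.
  assert (S : Defs.dist F1 F2 * Defs.dist F1 F2 = (fst F2 - fst F1) * (fst F2 - fst F1)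
                                      + (snd F2 - snd F1) * (snd F2 - snd F1)).
  { unfold Defs.dist, norm; rewrite sqrt_sqrt by apply sum_squares_nonneg.
    unfold dot, vsub; simpl; ring. }
  destruct (Req_dec (Defs.dist F1 F2) 0) as [E | E].
  (* Coinciding foci, the case of circles: any direction serves as axis. *)
  - exists 1, 0. rewrite E in *.
    pose proof (Rle_0_sqr (fst F2 - fst F1)); pose proof (Rle_0_sqr (snd F2 - snd F1)).
    unfold Rsqr in *. repeat split; [ring | |]; rewrite Rmult_0_l; apply Rsqr_0_uniq;
      unfold Rsqr; lra.
  - exists ((fst F2 - fst F1) / Defs.dist F1 F2), ((snd F2 - snd F1) / Defs.dist F1 F2).
    repeat split; [| field; exact E | field; exact E].
    transitivity (((fst F2 - fst F1) * (fst F2 - fst F1)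
      + (snd F2 - snd F1) * (snd F2 - snd F1)) / (Defs.dist F1 F2 * Defs.dist F1 F2)).
    + field; exact E.
    + rewrite S; field. rewrite <- S; nra.
Qed.

Definition coord1 (F1 F2 : pt) (e1 e2 : R) (P : pt) : R :=
  (fst P - (fst F1 + fst F2) / 2) * e1 + (snd P - (snd F1 + snd F2) / 2) * e2.
Definition coord2 (F1 F2 : pt) (e1 e2 : R) (P : pt) : R :=
  e1 * (snd P - (snd F1 + snd F2) / 2) - e2 * (fst P - (fst F1 + fst F2) / 2).

Section Frame.
Variables (F1 F2 : pt) (e1 e2 : R).
Hypothesis he : e1 * e1 + e2 * e2 = 1.
Hypothesis hF : fst F2 - fst F1 = Defs.dist F1 F2 * e1 /\ snd F2 - snd F1 = Defs.dist F1 F2 * e2.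
Let c := Defs.dist F1 F2 / 2.

Let x := coord1 F1 F2 e1 e2.
Let y := coord2 F1 F2 e1 e2.

Lemma half_focal_distance_lt s : is_ellipse F1 F2 s -> 0 <= c < s / 2.
Proof.
  unfold is_ellipse, c; assert (0 <= Defs.dist F1 F2) by apply sqrt_pos; lra.
Qed.

(** In the new coordinates the foci are [(-c, 0)] and [(c, 0)], so [focal_sum] applies. *)
Lemma on_ellipse_coord s P : is_ellipse F1 F2 s ->
  (on_ellipse F1 F2 s P <->
   (s / 2 * (s / 2) - c * c) * (x P * x P) + s / 2 * (s / 2) * (y P * y P)
   = s / 2 * (s / 2) * (s / 2 * (s / 2) - c * c)).
Proof.
  intros Hs. rewrite <- (focal_sum (s / 2) c _ _ (half_focal_distance_lt s Hs)).
  destruct hF as [h1 h2].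
  assert (E1 : dot (vsub P F1) (vsub P F1) = (x P + c) * (x P + c) + y P * y P).
  { transitivity ((fst P - (fst F1 + fst F2) / 2 + (fst F2 - fst F1) / 2)
        * (fst P - (fst F1 + fst F2) / 2 + (fst F2 - fst F1) / 2)
      + (snd P - (snd F1 + snd F2) / 2 + (snd F2 - snd F1) / 2)
        * (snd P - (snd F1 + snd F2) / 2 + (snd F2 - snd F1) / 2)).
    - unfold dot, vsub; simpl; field.
    - rewrite h1, h2; unfold x, y, coord1, coord2.
      set (u := fst P - _); set (v := snd P - _).
      transitivity ((u * u + v * v) * (e1 * e1 + e2 * e2) + 2 * c * (u * e1 + v * e2)
        + c * c * (e1 * e1 + e2 * e2)).
      + rewrite he at 1; unfold c; field.
      + rewrite he at 2; ring. }
  assert (E2 : dot (vsub P F2) (vsub P F2) = (x P - c) * (x P - c) + y P * y P).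
  { transitivity ((fst P - (fst F1 + fst F2) / 2 - (fst F2 - fst F1) / 2)
        * (fst P - (fst F1 + fst F2) / 2 - (fst F2 - fst F1) / 2)
      + (snd P - (snd F1 + snd F2) / 2 - (snd F2 - snd F1) / 2)
        * (snd P - (snd F1 + snd F2) / 2 - (snd F2 - snd F1) / 2)).
    - unfold dot, vsub; simpl; field.
    - rewrite h1, h2; unfold x, y, coord1, coord2.
      set (u := fst P - _); set (v := snd P - _).
      transitivity ((u * u + v * v) * (e1 * e1 + e2 * e2) - 2 * c * (u * e1 + v * e2)
        + c * c * (e1 * e1 + e2 * e2)).
      + rewrite he at 1; unfold c; field.
      + rewrite he at 2; ring. }
  unfold on_ellipse; change (Defs.dist P F1) with (sqrt (dot (vsub P F1) (vsub P F1))).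
  change (Defs.dist P F2) with (sqrt (dot (vsub P F2) (vsub P F2))).
  rewrite E1, E2. replace (2 * (s / 2)) with s by field. reflexivity.
Qed.

Lemma cross_coord P Q R S :
  cross (vsub P Q) (vsub R S)
  = (x P - x Q) * (y R - y S) - (y P - y Q) * (x R - x S).
Proof.
  transitivity (cross (vsub P Q) (vsub R S) * (e1 * e1 + e2 * e2)); [rewrite he; ring |].
  unfold cross, vsub, x, y, coord1, coord2; simpl; ring.
Qed.

Lemma norm_coord P Q :
  norm (vsub P Q) = sqrt ((x P - x Q) * (x P - x Q) + (y P - y Q) * (y P - y Q)).
Proof.
  unfold norm; f_equal.
  transitivity (dot (vsub P Q) (vsub P Q) * (e1 * e1 + e2 * e2)); [rewrite he; ring |].
  unfold dot, vsub, x, y, coord1, coord2; simpl; ring.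
Qed.

(** The coordinates are affine along the line, so uniqueness of the common point carries over to the
    Cartesian equation. *)
Lemma tangent_line_coord s b P Q : is_ellipse F1 F2 s ->
  0 < b -> b * b = s / 2 * (s / 2) - c * c -> tangent_line F1 F2 s P Q ->
  (x P * (y Q - y P) - y P * (x Q - x P)) * (x P * (y Q - y P) - y P * (x Q - x P))
  = b * b * ((x Q - x P) * (x Q - x P)) + s / 2 * (s / 2) * ((y Q - y P) * (y Q - y P)).
Proof.
  intros Hs Hb Eb [Hne [t [Ht Hu]]].
  pose proof (half_focal_distance_lt s Hs).
  assert (Lx : forall r, x (line_pt P Q r) = x P + r * (x Q - x P))
    by (intros r; unfold x, coord1, line_pt; simpl; ring).
  assert (Ly : forall r, y (line_pt P Q r) = y P + r * (y Q - y P))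
    by (intros r; unfold y, coord2, line_pt; simpl; ring).
  apply line_tangent_to_ellipse; [lra | exact Hb | |].
  - intros E; apply Hne.
    assert (N : dot (vsub Q P) (vsub Q P) = 0).
    { transitivity (norm (vsub Q P) * norm (vsub Q P)).
      - symmetry; apply sqrt_sqrt, sum_squares_nonneg.
      - rewrite norm_coord, E, sqrt_0; ring. }
    unfold dot, vsub in N; simpl in N.
    pose proof (Rle_0_sqr (fst Q - fst P)); pose proof (Rle_0_sqr (snd Q - snd P)).
    unfold Rsqr in *.
    assert (fst Q - fst P = 0) by (apply Rsqr_0_uniq; unfold Rsqr; lra).
    assert (snd Q - snd P = 0) by (apply Rsqr_0_uniq; unfold Rsqr; lra).
    rewrite (surjective_pairing P), (surjective_pairing Q); f_equal; lra.
  - exists t; split.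
    + apply (on_ellipse_coord s _ Hs) in Ht. rewrite Lx, Ly, <- Eb in Ht. exact Ht.
    + intros t' Ht'; apply Hu, (on_ellipse_coord s _ Hs). rewrite Lx, Ly, <- Eb. exact Ht'.
Qed.
End Frame.

(** * Passage to normalised coordinates and the two sums *)

Theorem theorem4 (F1 F2 : pt) (se sc : R) (N : nat) (P : nat -> pt) :
  is_ellipse F1 F2 sc -> is_ellipse F1 F2 se -> sc < se ->
  periodic_billiard F1 F2 se sc N P ->
  ((N mod 2 = 0)%nat ->
     sum1 (fun i => (-1) ^ i * sin (ext_angle P i)) N = 0) /\
  ((N mod 4 = 0)%nat ->
     sum1 (fun i => (-1) ^ i * sin (ext_angle P i)) (N / 2) = 0).
Proof.
  intros Hc He Hlt (Hper & Hon & Htan & _ & Hccw).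
  destruct (focal_frame F1 F2) as (e1 & e2 & he & hF).
  pose proof (half_focal_distance_lt F1 F2 sc Hc) as Ic.
  pose proof (half_focal_distance_lt F1 F2 se He) as Ie.
  set (c := Defs.dist F1 F2 / 2) in *. set (a := sc / 2) in *. set (A := se / 2) in *.
  assert (haA : a < A) by (unfold a, A; lra).
  assert (Pb : 0 < a * a - c * c) by nra.
  assert (PB : 0 < A * A - c * c) by nra.
  assert (Pk : 0 < A * A - a * a) by nra.
  (* The minor semi-axes. Confocality is the common [c], which yields
     [A^2 - a^2 = B^2 - b^2 = kap^2]. *)
  set (b := sqrt (a * a - c * c)). set (B := sqrt (A * A - c * c)).
  set (kap := sqrt (A * A - a * a)).
  assert (Eb : b * b = a * a - c * c) by (apply sqrt_sqrt; lra).
  assert (EB : B * B = A * A - c * c) by (apply sqrt_sqrt; lra).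
  assert (Ek : kap * kap = A * A - a * a) by (apply sqrt_sqrt; lra).
  assert (hb : 0 < b) by (apply sqrt_lt_R0; lra).
  assert (hB : 0 < B) by (apply sqrt_lt_R0; lra).
  assert (hk : 0 < kap) by (apply sqrt_lt_R0; lra).
  set (x := coord1 F1 F2 e1 e2) in *. set (y := coord2 F1 F2 e1 e2) in *.
  (* Cosine and sine of the eccentric angle of [P i]. *)
  set (X := fun i => x (P i) / A). set (Y := fun i => y (P i) / B).
  assert (hX : forall i, A * X i = x (P i)) by (intros i; unfold X; field; lra).
  assert (hY : forall i, B * Y i = y (P i)) by (intros i; unfold Y; field; lra).
  assert (hwx : forall i, A * (X (S i) - X i) = x (P (S i)) - x (P i))
    by (intros i; rewrite <- !hX; ring).
  assert (hwy : forall i, B * (Y (S i) - Y i) = y (P (S i)) - y (P i))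
    by (intros i; rewrite <- !hY; ring).
  assert (hunit : forall i, X i * X i + Y i * Y i = 1).
  { intros i. assert (E := proj1 (on_ellipse_coord F1 F2 e1 e2 he hF se (P i) He) (Hon i)).
    fold x y c A in E. rewrite <- EB in E.
    transitivity ((B * B * (x (P i) * x (P i)) + A * A * (y (P i) * y (P i))) / (A * A * (B * B))).
    - unfold X, Y; field; lra.
    - rewrite E; field; lra. }
  assert (hcr : forall i, A * B * (X i * Y (S i) - Y i * X (S i))
    = x (P i) * (y (P (S i)) - y (P i)) - y (P i) * (x (P (S i)) - x (P i)))
    by (intros i; rewrite <- !hX, <- !hY; ring).
  assert (hm : forall i, 0 < A * B * (X i * Y (S i) - Y i * X (S i))).
  { intros i. rewrite hcr. specialize (Hccw i). rewrite Nat.add_1_r in Hccw.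
    rewrite (cross_coord F1 F2 e1 e2 he) in Hccw. fold x y in Hccw.
    (* The centre is the origin of the frame, so counterclockwise traversal says that consecutive
       vertices have positive cross product. *)
    replace (x ((fst F1 + fst F2) / 2, (snd F1 + snd F2) / 2)) with 0 in Hccw
      by (unfold x, coord1; simpl; ring).
    replace (y ((fst F1 + fst F2) / 2, (snd F1 + snd F2) / 2)) with 0 in Hccw
      by (unfold y, coord2; simpl; ring).
    lra. }
  assert (htan : forall i, A * B * (X i * Y (S i) - Y i * X (S i))
      * (A * B * (X i * Y (S i) - Y i * X (S i)))
    = b * b * (A * (X (S i) - X i) * (A * (X (S i) - X i)))
      + a * a * (B * (Y (S i) - Y i) * (B * (Y (S i) - Y i)))).
  { intros i. rewrite hcr, hwx, hwy.
    specialize (Htan i). rewrite Nat.add_1_r in Htan.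
    exact (tangent_line_coord F1 F2 e1 e2 he hF sc b _ _ Hc hb Eb Htan). }
  assert (ha : 0 < a) by lra. assert (hA : 0 < A) by lra.
  assert (hAa : A * A = a * a + kap * kap) by lra.
  assert (hBb : B * B = b * b + kap * kap) by lra.
  pose proof (edge_length_pos a b A B X Y hm htan) as Hlen.
  pose proof (cross_consecutive_edges a b kap A B X Y ha hb hk hA hB hAa hBb hunit hm htan) as Hcross.
  pose proof (support_half_period a b kap A B X Y ha hb hk hA hB hAa hBb hunit hm htan) as Hhalf.
  cbv zeta beta in Hlen, Hcross, Hhalf.
  (* [kap / (A B)] times the distance from the centre to edge [i]. *)
  set (g := fun i => kap / (A * B) * (A * B * (X i * Y (S i) - Y i * X (S i))
    / sqrt (A * (X (S i) - X i) * (A * (X (S i) - X i))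
            + B * (Y (S i) - Y i) * (B * (Y (S i) - Y i))))).
  assert (hlen : forall i, norm (vsub (P (S i)) (P i))
    = sqrt (A * (X (S i) - X i) * (A * (X (S i) - X i))
            + B * (Y (S i) - Y i) * (B * (Y (S i) - Y i)))).
  { intros i. rewrite (norm_coord F1 F2 e1 e2 he). fold x y. rewrite hwx, hwy. reflexivity. }
  assert (Hsin : forall i, sin (ext_angle P (S i)) = g i + g (S i)).
  { intros i. unfold ext_angle.
    replace (S i - 1)%nat with i by lia. rewrite Nat.add_1_r.
    assert (Q : cross (vsub (P (S i)) (P i)) (vsub (P (S (S i))) (P (S i)))
      / (norm (vsub (P (S i)) (P i)) * norm (vsub (P (S (S i))) (P (S i)))) = g i + g (S i)).
    { rewrite !hlen, (cross_coord F1 F2 e1 e2 he). fold x y. rewrite <- !hwx, <- !hwy.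
      rewrite Hcross. unfold g; ring. }
    assert (Hg : forall j, 0 < g j).
    { intros j; unfold g. apply Rmult_lt_0_compat; apply Rdiv_lt_0_compat; auto.
      apply Rmult_lt_0_compat; assumption. }
    pose proof (Hlen i) as L1; pose proof (Hlen (S i)) as L2.
    rewrite <- hlen in L1, L2.
    rewrite sin_angle; [exact Q | exact L1 | exact L2 |].
    (* The sign required by [sin_angle] comes from [Q], whose right side is positive. *)
    apply Rmult_le_reg_r with (/ (norm (vsub (P (S i)) (P i)) * norm (vsub (P (S (S i))) (P (S i))))).
    - apply Rinv_0_lt_compat, Rmult_lt_0_compat; assumption.
    - rewrite Rmult_0_l. unfold Rdiv in Q. rewrite Q. pose proof (Hg i); pose proof (Hg (S i)); lra. }
  assert (even : forall n, (-1) ^ (n + n) = 1).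
  { intros n. replace (n + n)%nat with (2 * n)%nat by lia. apply pow_1_even. }
  assert (pX : forall i, X (i + N)%nat = X i) by (intros i; unfold X; rewrite Hper; reflexivity).
  assert (pY : forall i, Y (i + N)%nat = Y i) by (intros i; unfold Y; rewrite Hper; reflexivity).
  split; intros HN; rewrite (alternating_sum_telescopes _ g _ Hsin).
  - apply Nat.Div0.mod_divides in HN; destruct HN as [h Hh].
    assert (E : g N = g 0%nat).
    { unfold g. rewrite <- (pX 0%nat), <- (pY 0%nat), <- (pX 1%nat), <- (pY 1%nat). reflexivity. }
    rewrite E. replace N with (h + h)%nat by lia. rewrite even; ring.
  - apply Nat.Div0.mod_divides in HN; destruct HN as [h Hh].
    (* Divisibility by 4 makes [N / 2] even, so the telescoped sum is [g (N / 2) - g 0]; this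
       vanishes by the half-period lemma with [h + h] as half period. *)
    assert (E2 : (N / 2 = h + h)%nat).
    { rewrite Hh. replace (4 * h)%nat with ((h + h) * 2)%nat by lia. apply Nat.div_mul; lia. }
    rewrite E2, even.
    replace N with ((h + h) + (h + h))%nat in pX, pY by lia.
    unfold g. rewrite (Hhalf (h + h)%nat pX pY). ring.
Qed.
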